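(* Let $H$ be a Hilbert space. For every bounded sequence $(u_n)_{n \in \mathbb{N}}$ in $H$ the inequality $$\limsup_{N \to \infty} \sup_{|\lambda| = 1}\left\|\frac{1}{N} \sum_{n=1}^N \lambda^n u_n\right\|^2 \leq \liminf_{J \to \infty} \frac{1}{J}\sum_{j=1}^J \limsup_{N \to \infty} \left|\frac{1}{N}\sum_{n=1}^{N} (u_n|u_{n+j})\right|$$ holds, where the supremum is over all $\lambda \in \mathbb{C}$ with $|\lambda| = 1$.
   Context: $\mathbb{N} = \{1,2,3,\dots\}$. Hilbert spaces are complex, and $(\cdot|\cdot)$ denotes the inner product of $H$ (linear in the first argument). *)

(* Defs.v *)
From mathcomp Require Import all_boot all_order all_algebra.
From mathcomp Require Import complex.
From mathcomp Require Import all_classical all_reals all_analysis.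
Import Order.TTheory GRing.Theory Num.Theory.
Import numFieldNormedType.Exports.

Set Implicit Arguments.
Unset Strict Implicit.
Unset Printing Implicit Defensive.

Local Open Scope classical_set_scope.
Local Open Scope ring_scope.
Local Open Scope complex_scope.

(* Over the scalar field [R[i]] the library's norm [`|x|] is an element of
   [R[i]] (a nonnegative real one); [rnorm x] is that number in [R]. With
   [V := R[i]] it is the modulus of a complex number. *)
Definition rnorm (R : realType) (V : normedZmodType R[i]) (x : V) : R :=
  complex.Re `|x|.

(* A complex Hilbert space is a complete normed module [H] over [R[i]] whose
   norm comes from an inner product [ip]. By [{dot H for Num.conj}], [ip] is
   Hermitian, positive definite, linear in its first argument and
   conjugate-linear in its second one. *)
Definition hilbert_product (R : realType) (H : completeNormedModType R[i])
    (ip : {dot H for Num.conj}) : Prop :=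
  forall x : H, `|x| ^+ 2 = ip x x.

(* Main.v *)
Require Import Defs.
From HB Require Import structures.
From mathcomp Require Import all_boot all_order all_algebra.
From mathcomp Require Import complex ring lra.
From mathcomp Require Import all_classical all_reals all_analysis.
Import Order.TTheory GRing.Theory Num.Theory.
Import numFieldNormedType.Exports.

Set Implicit Arguments.
Unset Strict Implicit.
Unset Printing Implicit Defensive.

Local Open Scope classical_set_scope.
Local Open Scope ring_scope.

(** Write [v_N n = l_N ^+ n *: u n], where [l_N] is a unimodular number that
nearly realises the supremum for [N], and let [a_N] be the mean of
[v_N 1, ..., v_N N]. The twist is harmless: [(v_N n | v_N (n + j))] is
[(u n | u (n + j))] multiplied by a unimodular constant that does not depend
on [n], so every correlation average keeps its modulus.

Fix a real [r] below the left-hand side. Then [r <= |a_N| ^+ 2] for infinitely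
many [N], and there is an ultrafilter [F] of large [N] that lives on these
[N]. Bounded double sequences [x N n] of vectors carry the semi-inner product
[B x y], the limit along [F] of the averages over [1 <= n <= N] of
[Re (x N n | y N n)]. The shift [U] in the variable [n] is an isometry for [B],
since shifting changes the averages by [O(1 / N)]. For the same reason adding a
coboundary [U y - y] to [v] does not affect its means in the limit, so Jensen's
inequality gives [r <= B w w] for every [w] in the affine space
[v + range (U - 1)] ([ultra_form_cohomologous_ge]).

What remains is the mean ergodic theorem, in a form where near minimisers of
the norm replace a projection ([isometry_ergodic_lower_bound]). Let [b] nearly
minimise [B w w] on that affine space. The space is [U]-invariant, so every
[U^j b] is as good as [b], and a near minimiser is nearly orthogonal to all
directions of the space, in particular to [v - U^j b]. Hence [B v (U^j b)] is
at least [r] up to a small error, for every [j]. As [v - b] is a coboundary, the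
average of [B v (U^j v)] over [1 <= j <= J] differs from that of [B v (U^j b)]
by [O(1 / J)], so it is at least [r - e] for all large [J]. Passing to the
limit along one common ultrafilter before letting [J] grow is what allows a
lower limit in [J], and the constant 1, on the right-hand side; the classical
van der Corput inequality would give twice a Fejer mean of the correlations.

Finally [B v (U^j v)] is the limit along [F] of averages which are bounded by
the modulus of the averaged correlation of [u] at lag [j], so it is at most the
upper limit of these moduli. *)

(** * Semi-inner products and the mean ergodic theorem *)

(** The axioms are relative to a subspace [S] because a form defined through
limits is bilinear only on the vectors for which the limits exist. *)
Record semi_inner (R : realType) (V : lmodType R) (S : set V)
    (f : V -> V -> R) : Prop := SemiInner {
  semi_inner_memD : forall x y, S x -> S y -> S (x + y);
  semi_inner_memZ : forall t x, S x -> S (t *: x);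
  semi_innerC : forall x y, S x -> S y -> f x y = f y x;
  semi_innerDr : forall x y z, S x -> S y -> S z -> f x (y + z) = f x y + f x z;
  semi_innerZr : forall t x y, S x -> S y -> f x (t *: y) = t * f x y;
  semi_inner_ge0 : forall x, S x -> 0 <= f x x }.

Section SemiInner.
Context (R : realType) (V : lmodType R) (S : set V) (f : V -> V -> R).
Hypothesis fS : semi_inner S f.
Implicit Types (x y : V) (t : R).

Lemma semi_inner_memN x : S x -> S (- x).
Proof. by move=> Sx; rewrite -scaleN1r; apply: (semi_inner_memZ fS). Qed.

Lemma semi_inner_memB x y : S x -> S y -> S (x - y).
Proof.
by move=> Sx Sy; apply: (semi_inner_memD fS) => //; exact: semi_inner_memN.
Qed.

Lemma semi_innerNr x y : S x -> S y -> f x (- y) = - f x y.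
Proof. by move=> Sx Sy; rewrite -scaleN1r (semi_innerZr fS)// mulN1r. Qed.

Lemma semi_innerBr x y z : S x -> S y -> S z -> f x (y - z) = f x y - f x z.
Proof.
move=> Sx Sy Sz; rewrite (semi_innerDr fS)// ?semi_innerNr//.
exact: semi_inner_memN.
Qed.

Lemma semi_inner_normD x y t : S x -> S y ->
  f (x + t *: y) (x + t *: y) = f x x + 2 * t * f x y + t ^+ 2 * f y y.
Proof.
move=> Sx Sy; have Sty := semi_inner_memZ fS t Sy.
have Sxy := semi_inner_memD fS Sx Sty.
rewrite (semi_innerDr fS)// (semi_innerC fS Sxy Sx) (semi_innerC fS Sxy Sty).
rewrite !(semi_innerDr fS)// (semi_innerC fS Sty Sx) !(semi_innerZr fS)//.
by rewrite (semi_innerC fS Sty Sy) (semi_innerZr fS)//; ring.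
Qed.

(** A substitute for the Cauchy-Schwarz inequality: it bounds [f x y] by norms
linearly, without square roots. *)
Lemma semi_inner_AGM x y : S x -> S y -> 2 * `|f x y| <= f x x + f y y.
Proof.
move=> Sx Sy.
have := semi_inner_ge0 fS (semi_inner_memD fS Sx (semi_inner_memZ fS 1 Sy)).
have := semi_inner_ge0 fS (semi_inner_memD fS Sx (semi_inner_memZ fS (-1) Sy)).
rewrite !semi_inner_normD// => h1 h2.
have [h|h] := leP 0 (f x y).
  by rewrite ger0_norm//; nra.
by rewrite ltr0_norm//; nra.
Qed.

Lemma semi_inner_normD_le x y : S x -> S y ->
  f (x + y) (x + y) <= 2 * (f x x + f y y).
Proof.
move=> Sx Sy; rewrite -[y]scale1r semi_inner_normD// scale1r.
have := semi_inner_AGM Sx Sy; have := ler_norm (f x y); lra.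
Qed.

Lemma semi_inner_normB_le x y : S x -> S y ->
  f (x - y) (x - y) <= 2 * (f x x + f y y).
Proof.
move=> Sx Sy; rewrite -[- y]scaleN1r semi_inner_normD//.
have := semi_inner_AGM Sx Sy; have := ler_norm (- f x y); rewrite normrN; lra.
Qed.

(** In a Hilbert space the averages converge to the squared norm of the
projection of [v] on the fixed vectors of [U], which is the squared distance
from [v] to the closure of the range of [U - 1]. The proof replaces the
projection by a near minimiser of the norm on [v + range (U - 1)]. *)
Lemma isometry_ergodic_lower_bound (U : {linear V -> V}) (v : V) (r : R) :
    S v -> (forall x, S x -> S (U x)) ->
    (forall x y, S x -> S y -> f (U x) (U y) = f x y) ->
    (forall y, S y -> r <= f (v + (U y - y)) (v + (U y - y))) ->
  forall e, 0 < e -> exists J0, forall J, (J0 <= J)%N ->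
    r - e <= J%:R^-1 * \sum_(1 <= j < J.+1) f v (iter j U v).
Proof.
move=> Sv SU Uiso hr e e0.
have S0 : S 0 by rewrite -(scale0r v); apply: (semi_inner_memZ fS).
pose W y := v + (U y - y).
have SW y : S y -> S (W y).
  move=> Sy; apply: (semi_inner_memD fS) => //; apply: semi_inner_memB => //.
  exact: SU.
pose A := [set f (W y) (W y) | y in S].
have Ainf : has_inf A.
  split; first by exists (f (W 0) (W 0)), 0.
  by exists 0 => _ [y Sy <-]; apply: (semi_inner_ge0 fS); exact: SW.
pose m := inf A.
have mW y : S y -> m <= f (W y) (W y).
  by move=> Sy; apply: (ge_inf Ainf.2); exists y.
have rm : r <= m.
  by apply: lb_le_inf; [exact: Ainf.1|move=> _ [y Sy <-]; exact: hr].
have m0 : 0 <= m.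
  apply: lb_le_inf; first exact: Ainf.1.
  by move=> _ [y Sy <-]; apply: (semi_inner_ge0 fS); exact: SW.
have v0 := semi_inner_ge0 fS Sv.
(* [D] bounds the squared norms of the directions [v - U^j b]. The bound
   uses [t <= 1], as [b] is chosen within [t ^+ 2] of the infimum; and
   [t * (1 + D) <= e] makes the error in [near_min] at most [e / 2]. *)
pose D := 2 * (f v v + (m + 1)).
pose t := Num.min 1 (e / (1 + D)).
have D0 : 0 < 1 + D by rewrite /D; lra.
have t0 : 0 < t by rewrite lt_min ltr01 divr_gt0.
have t1 : t <= 1 by rewrite ge_min lexx.
have te : t * (1 + D) <= e by rewrite -ler_pdivlMr// ge_min lexx orbT.
have [_ [y Sy <-] bm] : exists2 z, A z & z < m + t ^+ 2.
  by apply: inf_adherent => //; rewrite exprn_gt0.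
have bm1 : f (W y) (W y) <= m + 1.
  by apply: (le_trans (ltW bm)); rewrite lerD2l exprn_ile1// ltW.
have Sit k x : S x -> S (iter k U x) by move=> Sx; elim: k => //= k; exact: SU.
have isoit k x : S x -> f (iter k U x) (iter k U x) = f x x.
  by move=> Sx; elim: k => //= k IH; rewrite Uiso//; exact: Sit.
(* [U (v + (U z - z))] belongs again to the affine space, with [v + U z] in
   the place of [z]. *)
have orbW k : exists2 z, S z & iter k U (W y) = W z.
  elim: k => [|k [z Sz IH]]; first by exists y.
  exists (v + U z); first by apply: (semi_inner_memD fS) => //; exact: SU.
  rewrite iterS IH /W !linearD /=.
  by rewrite addrACA (linearN U) [RHS]addrA [v + (_ - v)]addrC subrK.
(* Moving from the near minimiser [W z] by [t] towards [v] stays in the affine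
   space, so the squared norm drops by at most [t ^+ 2]; this bounds the
   first-order term [2 * t * f (W z) (v - W z)] from below. *)
have near_min k : m - e / 2 <= f v (iter k U (W y)).
  have [z Sz Ez] := orbW k.
  have Exx : f (W z) (W z) = f (W y) (W y) by rewrite -Ez isoit//; exact: SW.
  rewrite Ez; pose d := v - W z.
  have Sd : S d by apply: semi_inner_memB => //; exact: SW.
  have dD : f d d <= D.
    apply: (le_trans (semi_inner_normB_le Sv (SW _ Sz))).
    by rewrite /D ler_pM2l// lerD2l Exx.
  have Et : W z + t *: d = W ((1 - t) *: z).
    have -> : d = - (U z - z) by rewrite /d /W opprD addrA subrr sub0r.
    rewrite {2}/W linearZ /= -scalerBr /W scalerBl scale1r scalerN -addrA.
    by congr (_ + _).
  have := mW _ (semi_inner_memZ fS (1 - t) Sz).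
  rewrite -Et semi_inner_normD//; last exact: SW.
  have -> : f v (W z) = f (W z) (W z) + f (W z) d.
    rewrite [f v _](semi_innerC fS)//; last exact: SW.
    rewrite /d semi_innerBr//; try exact: SW.
    by rewrite addrCA subrr addr0.
  move: (mW _ Sy) te dD; rewrite Exx; set q := f (W z) d => h1 h2 h3 h4.
  suff : - (t * (1 + D)) <= 2 * q by lra.
  rewrite -(ler_pM2l t0); nra.
have Sk k : S (iter k U y) by exact: Sit.
(* The coboundary [U y - y] separating [W y] from [v] telescopes along the
   orbit. *)
have step k : f v (iter k U (W y)) =
    f v (iter k U v) + (f v (iter k.+1 U y) - f v (iter k U y)).
  have -> : iter k U (W y) = iter k U v + (iter k.+1 U y - iter k U y).
    elim: k => [//|k IH].
    by rewrite iterS IH !linearD linearN.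
  rewrite (semi_innerDr fS)//; [|exact: Sit|by apply: semi_inner_memB].
  by rewrite semi_innerBr.
have tele J : J%:R * (m - e / 2) <= \sum_(1 <= j < J.+1) f v (iter j U v)
    + (f v (iter J.+1 U y) - f v (U y)).
  elim: J => [|J IH]; first by rewrite mul0r big_nil subrr addr0.
  rewrite big_nat_recr//= -natr1 mulrDl mul1r.
  move: (near_min J.+1); rewrite step; move: IH => /=; lra.
pose C := f v v + f y y.
have bC k : `|f v (iter k U y)| <= C / 2.
  have := semi_inner_AGM Sv (Sk k); rewrite isoit// /C; lra.
have C0 : 0 <= C by rewrite /C addr_ge0// (semi_inner_ge0 fS).
exists (Num.truncn (C / (e / 2))).+1 => J hJ.
have J0 : 0 < J%:R :> R by rewrite ltr0n; exact: leq_trans hJ.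
have CJ : C <= J%:R * (e / 2).
  rewrite -ler_pdivrMr ?divr_gt0//.
  apply: (le_trans (ltW (truncnS_gt _))).
  by rewrite ler_nat.
rewrite mulrC ler_pdivlMr//.
have := tele J; have := bC J.+1; have := bC 1%N.
rewrite !ler_norml /= => /andP[h1 h2] /andP[h3 h4] h5.
nra.
Qed.

End SemiInner.

(** * Averages and means *)

Definition average (R : realType) (g : nat -> R) (N : nat) : R :=
  N%:R^-1 * \sum_(1 <= n < N.+1) g n.

Definition mean (R : realType) (V : lmodType R) (x : nat -> V) (N : nat) : V :=
  N%:R^-1 *: \sum_(1 <= n < N.+1) x n.

Lemma ler_norm_average (R : realType) (g : nat -> R) (C : R) (N : nat) :
  (forall n, `|g n| <= C) -> `|average g N| <= C.
Proof.
move=> gC; have C0 : 0 <= C := le_trans (normr_ge0 _) (gC 0%N).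
rewrite /average normrM normfV normr_nat.
have [->|N0] := posnP N; first by rewrite invr0 mul0r.
rewrite mulrC ler_pdivrMr ?ltr0n//; apply: (le_trans (ler_norm_sum _ _ _)).
apply: (@le_trans _ _ (\sum_(1 <= n < N.+1) C)); first exact: ler_sum.
by rewrite sumr_const_nat subSS subn0 mulr_natr.
Qed.

Lemma average_ge0 (R : realType) (g : nat -> R) (N : nat) :
  (forall n, 0 <= g n) -> 0 <= average g N.
Proof. by move=> g0; rewrite mulr_ge0// ?invr_ge0// sumr_ge0. Qed.

Lemma averageD (R : realType) (g h : nat -> R) (N : nat) :
  average (fun n => g n + h n) N = average g N + average h N.
Proof. by rewrite /average big_split mulrDr. Qed.

Lemma averageZ (R : realType) (t : R) (g : nat -> R) (N : nat) :
  average (fun n => t * g n) N = t * average g N.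
Proof. by rewrite /average -mulr_sumr mulrCA. Qed.

Section Mean.
Context (R : realType) (E : lmodType R) (f : E -> E -> R).
Hypothesis fT : semi_inner setT f.

Lemma semi_inner_sumr a (x : nat -> E) m n :
  f a (\sum_(m <= i < n) x i) = \sum_(m <= i < n) f a (x i).
Proof.
apply: (big_ind2 (fun b c => f a b = c)) => [|b c b' c' <- <-|//].
  by rewrite -(scale0r 0) (semi_innerZr fT)// mul0r.
by rewrite (semi_innerDr fT).
Qed.

Lemma average_semi_innerr a (x : nat -> E) N :
  average (fun n => f a (x n)) N = f a (mean x N).
Proof. by rewrite /mean (semi_innerZr fT)// semi_inner_sumr. Qed.

(** This is [0 <= f (x n - a) (x n - a)], averaged. With [a] the mean of [x]
it becomes Jensen's inequality; keeping [a] free allows it to be compared with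
the mean of a slightly different sequence. *)
Lemma average_normsq_ge a (x : nat -> E) N : (0 < N)%N ->
  2 * f a (mean x N) - f a a <= average (fun n => f (x n) (x n)) N.
Proof.
move=> N0; rewrite -average_semi_innerr -averageZ.
have {1}-> : f a a = average (fun=> f a a) N.
  rewrite /average sumr_const_nat subSS subn0 -[f a a *+ N]mulr_natl.
  by rewrite mulKf// pnatr_eq0 -lt0n.
suff : 0 <= average (fun n => f (x n) (x n) + (-1 * (2 * f a (x n)) + f a a)) N.
  by rewrite !averageD !averageZ; lra.
apply: average_ge0 => n.
have := semi_inner_ge0 fT (I : setT (x n + (-1) *: a)).
rewrite (semi_inner_normD fT)// (semi_innerC fT (I : setT (x n)) I); lra.
Qed.

Lemma normsq_mean_le (x : nat -> E) N : (0 < N)%N ->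
  f (mean x N) (mean x N) <= average (fun n => f (x n) (x n)) N.
Proof. by move=> N0; have := average_normsq_ge (mean x N) x N0; lra. Qed.

Lemma mean_telescope (y : nat -> E) N :
  mean (fun n => y n.+1 - y n) N = N%:R^-1 *: (y N.+1 - y 1%N).
Proof. by rewrite /mean telescope_sumr. Qed.

(** Adding a coboundary moves the mean only by [(y N.+1 - y 1) / N]. The
constant 5 is [4 * C] for the squared norm of [y N.+1 - y 1] plus [C] for that
of the mean. *)
Lemma average_normsq_cohomologous_ge (x y : nat -> E) N C : (0 < N)%N ->
  (forall n, f (x n) (x n) <= C) -> (forall n, f (y n) (y n) <= C) ->
  f (mean x N) (mean x N) - N%:R^-1 * (5 * C)
    <= average (fun n => f (x n + (y n.+1 - y n)) (x n + (y n.+1 - y n))) N.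
Proof.
move=> N0 xC yC; set a := mean x N.
have aC : f a a <= C.
  apply: (le_trans (normsq_mean_le x N0)); apply: (le_trans (ler_norm _)).
  apply: ler_norm_average => n; rewrite ger0_norm//; exact: (semi_inner_ge0 fT).
apply: le_trans (average_normsq_ge a (fun n => x n + (y n.+1 - y n)) N0).
have -> : mean (fun n => x n + (y n.+1 - y n)) N
    = a + N%:R^-1 *: (y N.+1 - y 1%N).
  by rewrite -mean_telescope /mean big_split scalerDr.
set d := y N.+1 - y 1%N.
rewrite (semi_innerDr fT)// [f a (_ *: d)](semi_innerZr fT)//.
have dC : f d d <= 4 * C.
  apply: (le_trans (semi_inner_normB_le fT I I)).
  by have := yC N.+1; have := yC 1%N; lra.
have := semi_inner_AGM fT (I : setT a) (I : setT d).
have := ler_norm (- f a d); rewrite normrN => h1 h2.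
have : 0 <= N%:R^-1 * (2 * f a d + 5 * C).
  by apply: mulr_ge0; [rewrite invr_ge0|lra].
by rewrite mulrDr mulrCA; lra.
Qed.

End Mean.

(** * The form on bounded double sequences obtained along an ultrafilter *)

Lemma ultrafilter_bounded_cvg (R : realType) (T : Type) (F : set_system T)
    (g : T -> R) (C : R) :
  UltraFilter F -> (forall t, `|g t| <= C) -> cvg (g @ F).
Proof.
move=> FU gC; have FF := @ultra_proper _ _ FU.
have gF : (g @ F) [set` `[- C, C]].
  by apply: (@filterE _ F) => t; rewrite /= in_itv /= -ler_norml; exact: gC.
have [p [_ clp]] := segment_compact (fmap_proper_filter g FF) gF.
apply/cvg_ex; exists p => A pA.
have [//|FnA] := in_ultra_setVsetC (g @^-1` A) FU.
by have [x [nAx Ax]] := clp _ _ (FnA : (g @ F) (~` A)) pA.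
Qed.

Definition bounded_rows (R : realType) (E : lmodType R) (f : E -> E -> R) :
    set (nat -> nat -> E) :=
  [set x | exists C, forall N n, f (x N n) (x N n) <= C].

(** The row index [N] is the length of the average, so each average may see a
different sequence; this is what accommodates frequencies depending on [N]. *)
Definition ultra_form (R : realType) (E : lmodType R) (f : E -> E -> R)
    (F : set_system nat) (x y : nat -> nat -> E) : R :=
  lim (average (fun n => f (x N n) (y N n)) N @[N --> F]).

Definition shift (E : Type) (x : nat -> nat -> E) : nat -> nat -> E :=
  fun N n => x N n.+1.

Section ShiftLinear.
Context (R : realType) (E : lmodType R).
Lemma shift_is_linear : linear (@shift E).
Proof. by []. Qed.
HB.instance Definition _ := GRing.isLinear.Build R (nat -> nat -> E)
  (nat -> nat -> E) _ (@shift E) shift_is_linear.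
End ShiftLinear.

Section UltraForm.
Context (R : realType) (E : lmodType R) (f : E -> E -> R).
Hypothesis fT : semi_inner setT f.
Context (F : set_system nat) (FU : UltraFilter F) (F_oo : \oo `<=` F).
Let B := ultra_form f F.
Let S := bounded_rows f.

Let FF : ProperFilter F := @ultra_proper _ _ FU.

Lemma semi_inner_le a b (C : R) : f a a <= C -> f b b <= C -> `|f a b| <= C.
Proof.
by move=> aC bC; have := semi_inner_AGM fT (I : setT a) (I : setT b); lra.
Qed.

Lemma bounded_rows_max x y : S x -> S y ->
  exists C, (forall N n, f (x N n) (x N n) <= C) /\
            (forall N n, f (y N n) (y N n) <= C).
Proof.
move=> [C xC] [D yD]; exists (Num.max C D).
by split=> N n; rewrite le_max ?xC ?yD ?orbT.
Qed.

Lemma ultra_form_cvg x y : S x -> S y ->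
  average (fun n => f (x N n) (y N n)) N @[N --> F] --> B x y.
Proof.
move=> Sx Sy; have [C [xC yC]] := bounded_rows_max Sx Sy.
apply: (@ultrafilter_bounded_cvg _ _ _ _ C FU) => N.
by apply: ler_norm_average => n; exact: semi_inner_le.
Qed.

Lemma ultra_form_semi_inner : semi_inner S B.
Proof.
have SD x y : S x -> S y -> S (x + y).
  move=> Sx Sy; have [C [xC yC]] := bounded_rows_max Sx Sy.
  exists (2 * (C + C)) => N n.
  apply: (le_trans (semi_inner_normD_le fT I I)).
  by rewrite ler_pM2l// lerD.
have SZ t x : S x -> S (t *: x).
  move=> [C xC]; exists (t ^+ 2 * C) => N n.
  rewrite (semi_innerZr fT)// (semi_innerC fT)// (semi_innerZr fT)// mulrA.
  by rewrite -expr2 ler_wpM2l// sqr_ge0.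
split=> //.
- move=> x y _ _; rewrite /B /ultra_form.
  by under eq_fun do under eq_fun do rewrite (semi_innerC fT)//.
- move=> x y z Sx Sy Sz.
  apply: cvg_lim; first by [].
  rewrite [X in X @ _ --> _](_ : _ =
      (fun N => average (fun n => f (x N n) (y N n)) N) \+
      (fun N => average (fun n => f (x N n) (z N n)) N)).
    by apply: cvgD; exact: ultra_form_cvg.
  apply/funext => N /=; rewrite -averageD; congr average; apply/funext => n.
  by rewrite (semi_innerDr fT).
- move=> t x y Sx Sy.
  apply: cvg_lim; first by [].
  rewrite [X in X @ _ --> _](_ : _ =
      (fun N => t * average (fun n => f (x N n) (y N n)) N)).
    by apply: cvgMr; exact: ultra_form_cvg.
  apply/funext => N /=; rewrite -averageZ; congr average; apply/funext => n.
  by rewrite (semi_innerZr fT).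
- move=> x Sx; apply: (cvgr_to_ge (ultra_form_cvg Sx Sx)).
  apply: filterE => N; apply: average_ge0 => n; exact: (semi_inner_ge0 fT).
Qed.

Lemma bounded_rows_shift x : S x -> S (shift x).
Proof. by move=> [C xC]; exists C => N n; exact: xC. Qed.

Lemma ultra_cvg_invn (g : nat -> R) (C : R) :
  (forall N, `|g N| <= C) -> N%:R^-1 * g N @[N --> F] --> 0.
Proof.
move=> gC; have C0 : 0 <= C := le_trans (normr_ge0 _) (gC 0%N).
apply/cvgrPdist_le => e e0; apply: F_oo.
exists (Num.truncn (C / e)).+1 => // N /= hN.
have N0 : 0 < N%:R :> R by rewrite ltr0n; exact: leq_trans hN.
rewrite sub0r normrN normrM normfV normr_nat mulrC ler_pdivrMr//.
apply: (le_trans (gC N)); rewrite mulrC -ler_pdivrMr//.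
by apply: (le_trans (ltW (truncnS_gt _))); rewrite ler_nat.
Qed.

(** The two averages differ by boundary terms divided by [N]. *)
Lemma ultra_form_shift x y : S x -> S y -> B (shift x) (shift y) = B x y.
Proof.
move=> Sx Sy; have [C [xC yC]] := bounded_rows_max Sx Sy.
apply: cvg_lim; first by [].
pose d N := f (x N N.+1) (y N N.+1) - f (x N 1%N) (y N 1%N).
rewrite [X in X @ _ --> _](_ : _ =
    (fun N => average (fun n => f (x N n) (y N n)) N) \+
    (fun N => N%:R^-1 * d N)).
  rewrite -[B x y]addr0; apply: cvgD; first exact: ultra_form_cvg.
  apply: (@ultra_cvg_invn _ (C + C)) => N.
  apply: (le_trans (ler_normB _ _)); apply: lerD; exact: semi_inner_le.
apply/funext => N /=; rewrite /average -mulrDr; congr (_ * _).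
rewrite /d -(telescope_sumr (fun n => f (x N n) (y N n)) (isT : (1 <= N.+1)%N)).
by rewrite -big_split /=; apply: eq_bigr => n _; rewrite addrCA subrr addr0.
Qed.

Lemma ultra_form_cohomologous_ge (v y : nat -> nat -> E) (r : R) :
  S v -> S y ->
  (\forall N \near F, r <= f (mean (v N) N) (mean (v N) N)) ->
  r <= B (v + (shift y - y)) (v + (shift y - y)).
Proof.
move=> Sv Sy hr; have [C [vC yC]] := bounded_rows_max Sv Sy.
have BS := ultra_form_semi_inner.
have Sw : S (v + (shift y - y)).
  apply: (semi_inner_memD BS) => //; apply: (semi_inner_memB BS) => //.
  exact: bounded_rows_shift.
have cvgr : r - N%:R^-1 * (5 * C) @[N --> F] --> r.
  rewrite -[X in _ --> X]subr0; apply: cvgB; first exact: cvg_cst.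
  exact: (@ultra_cvg_invn (fun=> 5 * C) `|5 * C|).
rewrite -subr_ge0.
apply: (cvgr_to_ge (cvgB (ultra_form_cvg Sw Sw) cvgr)).
have N0 : F [set N | (0 < N)%N] by apply: F_oo; exists 1%N.
apply: filterS2 N0 hr => N /= N0 rN; rewrite subr_ge0.
apply: le_trans (average_normsq_cohomologous_ge fT N0 (vC N) (yC N)).
by rewrite lerB.
Qed.

(** The ergodic lower bound for the shift: the correlations of a family of
sequences dominate, on average, the squared norm of its means. *)
Theorem van_der_corput_ultra (v : nat -> nat -> E) (r : R) :
  S v -> (\forall N \near F, r <= f (mean (v N) N) (mean (v N) N)) ->
  forall e, 0 < e -> exists J0, forall J, (J0 <= J)%N ->
    r - e <= average (fun j => B v (fun N n => v N (n + j)%N)) J.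
Proof.
move=> Sv hr e e0.
have [J0 hJ] := isometry_ergodic_lower_bound ultra_form_semi_inner Sv
  bounded_rows_shift ultra_form_shift
  (fun y Sy => ultra_form_cohomologous_ge Sv Sy hr) e0.
exists J0 => J /hJ; congr (_ <= _ * _); apply: eq_bigr => j _; congr (B v _).
elim: j => [|j IH]; apply/funext => N; apply/funext => n; first by rewrite addn0.
by rewrite iterS IH addnS.
Qed.

End UltraForm.

(** * Upper and lower limits in the extended reals *)

Section EsupEinf.
Context (R : realType).
Local Open Scope ereal_scope.
Implicit Types (g : nat -> \bar R).

Lemma limn_esup_frequently_gt g (r : \bar R) : r < limn_esup g ->
  forall P, \oo P -> exists2 N, P N & r < g N.
Proof.
move=> rg P PN; have [] : exists2 z, [set g x | x in P] z & r < z.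
  apply: ereal_sup_gt; apply: (lt_le_trans rg).
  by apply: ereal_inf_lbound; exists P.
by move=> _ [N PNN <-] rN; exists N.
Qed.

Lemma le_limn_einf_near g (r : \bar R) :
  (\forall N \near \oo, r <= g N) -> r <= limn_einf g.
Proof.
move=> rg; rewrite /limn_einf -[limn_esup _]/(limf_esup _ _).
rewrite -[- _]/(limf_einf g \oo) limf_einfE.
apply: (@le_trans _ _ (ereal_inf [set g x | x in [set N | r <= g N]])).
  by apply: le_ereal_inf_tmp => _ [N rN <-].
by apply: ereal_sup_ubound; exists [set N | r <= g N].
Qed.

Lemma filter_lim_le_limn_esup (F : set_system nat) (a : nat -> R) (l : R) g :
  ProperFilter F -> \oo `<=` F -> a N @[N --> F] --> l ->
  (forall N, (a N)%:E <= g N) -> l%:E <= limn_esup g.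
Proof.
move=> FF Foo al ag; apply: le_ereal_inf_tmp => _ [P Poo <-].
have aP N : P N -> (a N)%:E <= ereal_sup [set g x | x in P].
  by move=> PN; apply: (le_trans (ag N)); apply: ereal_sup_ubound; exists N.
case: (ereal_sup _) aP => [s||] aP; last 2 first.
- by rewrite leey.
- by have [N /aP] := filter_ex Poo.
rewrite lee_fin; apply: (cvgr_to_le al).
by apply: filterS (Foo _ Poo) => N /aP; rewrite lee_fin.
Qed.

Lemma lee_real_lt (x y : \bar R) :
  (forall r : R, r%:E < x -> r%:E <= y) -> x <= y.
Proof.
case: x => [x||] h; last by rewrite leNye.
- apply/lee_subgt0Pr => e e0; by apply: h; rewrite lte_fin ltrBlDr ltrDl.
- case: y h => [y||] h; first 2 last.
  + by have := h 0%R (ltry _).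
  + by have := h (y + 1)%R (ltry _); rewrite lee_fin gerDl ler10.
  + by [].
Qed.
End EsupEinf.

(** * Complex Hilbert spaces as real semi-inner product spaces *)

(** Restriction of scalars from [R[i]] to [R]. A type alias is needed since the
carrier already has a module structure over [R[i]]. *)
Definition realified (R : realType) (H : lmodType R[i]) : Type := H.

Section Realified.
Context (R : realType) (H : lmodType R[i]).
HB.instance Definition _ := GRing.Zmodule.on (realified H).

Local Definition rscale (t : R) (x : realified H) : realified H :=
  (t%:C)%C *: (x : H).

Lemma rscaleA a b x : rscale a (rscale b x) = rscale (a * b) x.
Proof. by rewrite /rscale scalerA rmorphM. Qed.
Lemma rscale1 : left_id 1 rscale.
Proof. by move=> x; rewrite /rscale rmorph1 scale1r. Qed.
Lemma rscaleDr : right_distributive rscale +%R.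
Proof. by move=> t x y; rewrite /rscale scalerDr. Qed.
Lemma rscaleDl x : {morph rscale^~ x : a b / a + b}.
Proof. by move=> a b; rewrite /rscale rmorphD scalerDl. Qed.

HB.instance Definition _ := GRing.Zmodule_isLmodule.Build R (realified H)
  rscaleA rscale1 rscaleDr rscaleDl.
End Realified.

Section RealInner.
Context (R : realType) (H : completeNormedModType R[i]).
Context (ip : {dot H for Num.conj}) (ip_norm : hilbert_product ip).

Definition real_inner (x y : realified H) : R := complex.Re (ip x y).

Lemma real_inner_semi_inner : semi_inner setT real_inner.
Proof.
split=> //.
- move=> x y _ _; rewrite /real_inner hermC /= mul1r.
  by case: (ip y x).
- by move=> x y z _ _ _; rewrite /real_inner linearDr raddfD.
- move=> t x y _ _; rewrite /real_inner -[t *: y]/((t%:C)%C *: (y : H)).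
  rewrite linearZr_LR /=.
  by case: (ip x y) => a b /=; rewrite mulrC; simpc; rewrite mulrC.
- move=> x _; rewrite /real_inner.
  by have := dnorm_ge0 ip x; rewrite lecE => /andP[_].
Qed.

Lemma real_inner_normsq (x : H) : real_inner x x = rnorm x ^+ 2.
Proof.
rewrite /real_inner -ip_norm /rnorm.
have: 0 <= `|x| by [].
move: `|x| => [a b]; rewrite lecE => /andP[/eqP/= -> _].
by rewrite !expr2 /= mulr0 subr0.
Qed.
End RealInner.

Lemma Re_le_rnorm (R : realType) (z : R[i]) : complex.Re z <= rnorm z.
Proof.
rewrite /rnorm; have := normc_ge_Re z; rewrite lecE => /andP[_ /=].
exact: le_trans (ler_norm _).
Qed.

Lemma rnormM1 (R : realType) (l z : R[i]) : `|l| = 1 -> rnorm (l * z) = rnorm z.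
Proof. by move=> l1; rewrite /rnorm normrM l1 mul1r. Qed.

(** * Twisted sequences and the inequality *)

Lemma exists_ultrafilter_frequently (P : set nat) :
    (forall A, \oo A -> exists2 N, A N & P N) ->
  exists F : set_system nat, [/\ UltraFilter F, \oo `<=` F & F P].
Proof.
move=> freqP.
have WF : ProperFilter (within P \oo).
  by apply: Build_ProperFilter => /freqP[N AN PN]; exact: AN.
have [F [FU WsubF]] := ultraFilterLemma WF; exists F; split=> //.
- by move=> A Aoo; apply: WsubF; apply: filterS Aoo => N AN _.
- by apply: WsubF; exact: withinT.
Qed.

Section Twist.
Context (R : realType) (H : completeNormedModType R[i]).
Context (ip : {dot H for Num.conj}) (ip_norm : hilbert_product ip).
Context (u : nat -> H).

(** The hypothesis says nothing about the index 0, whose vector is bounded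
separately so that the constant serves all indices. *)
Lemma bounded_normsq : [bounded u n | n in [set n | (0 < n)%N]] ->
  exists C, forall n, real_inner ip (u n) (u n) <= C.
Proof.
move=> ub.
have pf : ProperFilter (globally [set n | (0 < n)%N]).
  by apply: (@globally_properfilter _ _ 1%N).
have [M uM] := (@ex_bound _ _ _ u _ pf).1 ub.
pose m := Num.max (complex.Re M) (rnorm (u 0%N)).
exists (m ^+ 2) => n; rewrite (real_inner_normsq ip_norm).
have rn0 k : 0 <= rnorm (u k).
  by have: 0 <= `|u k| by []; rewrite lecE => /andP[].
have m0 : 0 <= m by rewrite le_max rn0 orbT.
rewrite ler_sqr ?nnegrE// le_max.
case: n => [|n]; first by rewrite lexx orbT.
by have := uM n.+1 (ltn0Sn n); rewrite /= lecE => /andP[_ ->].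
Qed.

Definition twist (l : nat -> R[i]) : nat -> nat -> realified H :=
  fun N n => l N ^+ n *: u n.

(** The factors [l N ^+ n] cancel and leave a constant independent of [n]. *)
Lemma real_inner_twist (l : nat -> R[i]) N n j : `|l N| = 1 ->
  real_inner ip (twist l N n) (twist l N (n + j)) =
  complex.Re ((l N ^+ j)^* * ip (u n) (u (n + j)%N)).
Proof.
move=> l1; rewrite /real_inner /twist linearZl_LR linearZr_LR /=.
rewrite exprD rmorphM !mulrA.
have -> : l N ^+ n * (l N ^+ n)^* = 1.
  by rewrite -normCK normrX l1 expr1n expr1n.
by rewrite mul1r.
Qed.

Lemma average_Re (z : nat -> R[i]) N :
  average (fun n => complex.Re (z n)) N =
  complex.Re (N%:R^-1 * \sum_(1 <= n < N.+1) z n).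
Proof.
rewrite /average -(raddf_sum (@complex.Re R)).
have -> : (N%:R^-1 : R[i]) = (N%:R^-1)%:C%C by rewrite fmorphV rmorph_nat.
by case: (\sum_(_ <= _ < _) _) => a b /=; rewrite mul0r subr0.
Qed.

Lemma average_twist_le (l : nat -> R[i]) N j : `|l N| = 1 ->
  average (fun n => real_inner ip (twist l N n) (twist l N (n + j))) N <=
  rnorm (N%:R^-1 * \sum_(1 <= n < N.+1) ip (u n) (u (n + j)%N)).
Proof.
move=> l1; under eq_fun do rewrite real_inner_twist//.
rewrite average_Re -mulr_sumr mulrCA.
apply: (le_trans (Re_le_rnorm _)); rewrite rnormM1//.
by rewrite norm_conjC normrX l1 expr1n.
Qed.

Lemma mean_twist (l : nat -> R[i]) N :
  mean (twist l N) N = N%:R^-1 *: \sum_(1 <= n < N.+1) l N ^+ n *: u n :> H.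
Proof.
rewrite /mean -[_ *: _ in LHS]/((N%:R^-1)%:C%C *: (_ : H)).
by rewrite fmorphV rmorph_nat.
Qed.
End Twist.

Local Open Scope complex_scope.
Local Open Scope ereal_scope.

Theorem corollary5p4 (R : realType) (H : completeNormedModType R[i])
    (ip : {dot H for Num.conj}) (ip_norm : hilbert_product ip)
    (u : nat -> H) (u_bounded : [bounded u n | n in [set n | (0 < n)%N]]) :
  limn_esup (fun N : nat =>
    ereal_sup [set (rnorm ((N%:R)^-1 *: \sum_(1 <= n < N.+1) l ^+ n *: u n)
                      ^+ 2)%R%:E
              | l in [set l : R[i] | `|l|%R = 1%R]])
  <=
  limn_einf (fun J : nat =>
    ((J%:R)^-1)%R%:E *
    \sum_(1 <= j < J.+1)
      limn_esup (fun N : nat =>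
        (rnorm ((N%:R)^-1 * \sum_(1 <= n < N.+1) ip (u n) (u (n + j)%N)))%R%:E)).
Proof.
apply: lee_real_lt => r /limn_esup_frequently_gt rL.
pose good N (l : R[i]) := `|l|%R = 1%R /\
  (r <= rnorm ((N%:R)^-1 *: \sum_(1 <= n < N.+1) l ^+ n *: u n) ^+ 2)%R.
have [F [FU Foo Fgood]] : exists F : set_system nat,
    [/\ UltraFilter F, \oo `<=` F & F [set N | exists l, good N l]].
  apply: exists_ultrafilter_frequently => A /rL[N AN /ereal_sup_gt[_ [l l1 <-]]].
  by rewrite lte_fin => rl; exists N => //; exists l; split=> //; exact: ltW.
have FF := @ultra_proper _ _ FU.
(* Rows outside the good set get the default frequency 1, so that every [l N] is
   unimodular. *)
have /choice[l lP] : forall N, exists l : R[i],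
    `|l|%R = 1%R /\ ((exists l', good N l') -> good N l).
  move=> N; have [[l lg]|nl] := pselect (exists l, good N l).
    by exists l; split=> //; case: lg.
  by exists 1%R; split=> //; rewrite normr1.
have fT := real_inner_semi_inner ip.
pose v := twist u l.
have Sv : bounded_rows (real_inner ip) v.
  have [C uC] := bounded_normsq ip_norm u_bounded; exists C => N n.
  have := real_inner_twist ip u n 0 (lP N).1.
  by rewrite addn0 expr0 rmorph1 mul1r => ->; exact: uC.
have rv : \forall N \near F,
    (r <= real_inner ip (mean (v N) N) (mean (v N) N))%R.
  apply: filterS Fgood => N /(lP N).2[_].
  by rewrite (real_inner_normsq ip_norm) mean_twist.
apply/lee_subgt0Pr => e e0.
have [J0 hJ] := van_der_corput_ultra fT FU Foo Sv rv e0.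
apply: le_limn_einf_near; exists J0 => // J /= /hJ.
rewrite -lee_fin EFinB => /le_trans; apply.
rewrite /average EFinM -sumEFin; apply: lee_wpmul2l.
  by rewrite lee_fin invr_ge0.
apply: lee_sum => j _.
apply: (filter_lim_le_limn_esup FF Foo).
  apply: (ultra_form_cvg fT FU Sv).
  have [C vC] := Sv; exists C => N n; exact: vC.
by move=> N; rewrite lee_fin; apply: average_twist_le; exact: (lP N).1.
Qed.
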